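(* The linearized aided INS with a single point feature $\mathbf p$ in the state vector, observed by generic range and/or bearing measurements, has at least 4 unobservable directions, given by the columns of $$\mathbf N=\begin{bmatrix}\mathbf N_g & \mathbf 0_{12\times3}\\ -\lfloor\mathbf P_1\times\rfloor\mathbf g & \mathbf I_3\\ -\lfloor\mathbf p\times\rfloor\mathbf g&\mathbf I_3\end{bmatrix}.$$ That is, the 4 columns of $\mathbf N$ are linearly independent and $\mathbf M\mathbf N=\mathbf 0$, where $\mathbf M$ is the observability matrix.
   Context: $\lfloor\mathbf a\times\rfloor$ is the skew-symmetric matrix with $\lfloor\mathbf a\times\rfloor\mathbf b=\mathbf a\times\mathbf b$. All quantities below are evaluated at linearization points (state estimates); the same state variable always uses the same linearization point. At time steps $k=1,2,\dots$ (times $t_k$, $\delta t_k=t_k-t_1$), $\mathbf R_k\in SO(3)$ is the rotation from the global frame to the IMU/sensor frame, $\mathbf P_k,\mathbf V_k\in\mathbb R^3$ are IMU position and velocity in the global frame; $\mathbf g=(0,0,-g)^\top$, $g>0$, is gravity. For a continuous time $\tau$, $\mathbf R(\tau)$ and $\mathbf a(\tau)$ denote IMU orientation and IMU-frame linear acceleration. Error state ordering: (orientation error $\delta\boldsymbol\theta$, gyro bias, velocity, accelerometer bias, position, feature error); the first five blocks are 3-dimensional and the feature block has dimension $m$ (here $m=3$, the point $\mathbf p\in\mathbb R^3$ in global coordinates). State transition matrix: $$\boldsymbol\Phi_{(k,1)}=\begin{bmatrix}\Phi_{11}&\Phi_{12}&0&0&0&0\\0&\mathbf I_3&0&0&0&0\\\Phi_{31}&\Phi_{32}&\mathbf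 I_3&\Phi_{34}&0&0\\0&0&0&\mathbf I_3&0&0\\\Phi_{51}&\Phi_{52}&\Phi_{53}&\Phi_{54}&\mathbf I_3&0\\0&0&0&0&0&\mathbf I_m\end{bmatrix},$$ $\Phi_{11}=\mathbf R_k\mathbf R_1^\top$, $\Phi_{31}=-\lfloor(\mathbf V_k-\mathbf V_1+\mathbf g\,\delta t_k)\times\rfloor\mathbf R_1^\top$, $\Phi_{51}=\lfloor(\mathbf P_1+\mathbf V_1\delta t_k-\tfrac12\mathbf g\,\delta t_k^2-\mathbf P_k)\times\rfloor\mathbf R_1^\top$, $\Phi_{53}=\mathbf I_3\delta t_k$, $\Phi_{12}=-\int_{t_1}^{t_k}\mathbf R_k\mathbf R(\tau)^\top d\tau$, $\Phi_{32}=\int_{t_1}^{t_k}\mathbf R(s)^\top\lfloor\mathbf a(s)\times\rfloor\int_{t_1}^{s}\mathbf R(s)\mathbf R(\tau)^\top d\tau\,ds$, $\Phi_{52}=\int_{t_1}^{t_k}\int_{t_1}^{\theta}\mathbf R(s)^\top\lfloor\mathbf a(s)\times\rfloor\int_{t_1}^{s}\mathbf R(s)\mathbf R(\tau)^\top d\tau\,ds\,d\theta$, $\Phi_{34}=-\int_{t_1}^{t_k}\mathbf R(\tau)^\top d\tau$, $\Phi_{54}=-\int_{t_1}^{t_k}\int_{t_1}^{s}\mathbf R(\tau)^\top d\tau\,ds$. The measurement at step $k$ is a function of $\mathbf R_k(\mathbf p-\mathbf P_k)$ (range and/or bearing) and its Jacobian is $$\mathbf H_k=\mathbf H_{proj,k}\mathbf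 R_k\begin{bmatrix}\lfloor(\mathbf p-\mathbf P_k)\times\rfloor\mathbf R_k^\top&\mathbf 0_{3\times 9}&-\mathbf I_3&\mathbf I_3\end{bmatrix},$$ where $\mathbf H_{proj,k}$ (3 columns) is the Jacobian of the sensor's measurement function with respect to the sensor-frame point position. The observability matrix $\mathbf M$ is obtained by stacking $\mathbf H_k\boldsymbol\Phi_{(k,1)}$ over $k=1,2,\dots$; unobservable directions are vectors of its right null space. $\mathbf N_g=\begin{bmatrix}(\mathbf R_1\mathbf g)^\top&\mathbf 0_{1\times3}&-(\lfloor\mathbf V_1\times\rfloor\mathbf g)^\top&\mathbf 0_{1\times3}\end{bmatrix}^\top\in\mathbb R^{12}$. *)

(* Defs.v *)
From HB Require Import structures.
From mathcomp Require Import all_boot all_order all_algebra.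
From mathcomp Require Import all_classical all_reals all_analysis.
Set Implicit Arguments.
Unset Strict Implicit.
Unset Printing Implicit Defensive.
Import Order.TTheory GRing.Theory Num.Theory.
Import numFieldNormedType.Exports.
Local Open Scope classical_set_scope.
Local Open Scope ring_scope.

Definition SO3 (R : realType) : set 'M[R]_3 :=
  [set A | A^T *m A = 1%:M /\ \det A = 1].

Definition crossmx (R : realType) (a : 'cV[R]_3) : 'M[R]_3 :=
  let x := a 0 0 in let y := a 1 0 in let z := a 2 0 in
  \matrix_(i < 3, j < 3)
    nth 0 (nth [::] [:: [:: 0; - z; y];
                        [:: z; 0; - x];
                        [:: - y; x; 0]] i) j.

Definition gravity (R : realType) (g : R) : 'cV[R]_3 :=
  \col_(i < 3) nth 0 [:: 0; 0; - g] i.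

Definition mxint (R : realType) (m n : nat) (a b : R) (f : R -> 'M[R]_(m, n)) :
    'M[R]_(m, n) :=
  \matrix_(i < m, j < n) \int[lebesgue_measure]_(s in `[a, b]) (f s i j).

Definition row6 (R : realType) (m n1 n2 n3 n4 n5 n6 : nat)
    (A1 : 'M[R]_(m, n1)) (A2 : 'M[R]_(m, n2)) (A3 : 'M[R]_(m, n3))
    (A4 : 'M[R]_(m, n4)) (A5 : 'M[R]_(m, n5)) (A6 : 'M[R]_(m, n6)) :
    'M[R]_(m, n1 + n2 + n3 + n4 + n5 + n6) :=
  row_mx (row_mx (row_mx (row_mx (row_mx A1 A2) A3) A4) A5) A6.

Definition col6 (R : realType) (m1 m2 m3 m4 m5 m6 n : nat)
    (A1 : 'M[R]_(m1, n)) (A2 : 'M[R]_(m2, n)) (A3 : 'M[R]_(m3, n))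
    (A4 : 'M[R]_(m4, n)) (A5 : 'M[R]_(m5, n)) (A6 : 'M[R]_(m6, n)) :
    'M[R]_(m1 + m2 + m3 + m4 + m5 + m6, n) :=
  col_mx (col_mx (col_mx (col_mx (col_mx A1 A2) A3) A4) A5) A6.

(* Linearization point. Steps are numbered from 1: the values of [ltime], [lpos]
   and [lvel] at 0 are never used. A single orientation function [lrot] gives
   both R(tau) and R_k = R(t_k), so that the two always agree. The estimates are
   not required to satisfy the equations of motion exactly. *)
Record linearization (R : realType) := Linearization {
  ltime : nat -> R;
  lrot : R -> 'M[R]_3;         (* global frame to IMU frame *)
  lacc : R -> 'cV[R]_3;        (* in the IMU frame *)
  lpos : nat -> 'cV[R]_3;      (* in the global frame *)
  lvel : nat -> 'cV[R]_3;      (* in the global frame *)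
  lfeat : 'cV[R]_3 }.          (* in the global frame *)

Section AidedINS.
Context (R : realType) (g : R) (L : linearization R).

Definition rotk (k : nat) : 'M[R]_3 := lrot L (ltime L k).

Definition dt (k : nat) : R := ltime L k - ltime L 1.

Definition Phi11 (k : nat) : 'M[R]_3 := rotk k *m (rotk 1)^T.

Definition Phi31 (k : nat) : 'M[R]_3 :=
  - (crossmx (lvel L k - lvel L 1 + dt k *: gravity g) *m (rotk 1)^T).

Definition Phi51 (k : nat) : 'M[R]_3 :=
  crossmx (lpos L 1 + dt k *: lvel L 1 - (2^-1 * dt k ^+ 2) *: gravity g - lpos L k)
    *m (rotk 1)^T.

Definition Phi12 (k : nat) : 'M[R]_3 :=
  - mxint (ltime L 1) (ltime L k) (fun tau => rotk k *m (lrot L tau)^T).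

(* Common integrand of the outer integrals in Phi32 and Phi52. *)
Definition velocity_gyro_rate (s : R) : 'M[R]_3 :=
  (lrot L s)^T *m crossmx (lacc L s)
    *m mxint (ltime L 1) s (fun tau => lrot L s *m (lrot L tau)^T).

Definition Phi32 (k : nat) : 'M[R]_3 :=
  mxint (ltime L 1) (ltime L k) velocity_gyro_rate.

Definition Phi52 (k : nat) : 'M[R]_3 :=
  mxint (ltime L 1) (ltime L k)
    (fun theta => mxint (ltime L 1) theta velocity_gyro_rate).

Definition Phi34 (k : nat) : 'M[R]_3 :=
  - mxint (ltime L 1) (ltime L k) (fun tau => (lrot L tau)^T).

Definition Phi53 (k : nat) : 'M[R]_3 := (dt k)%:M.

Definition Phi54 (k : nat) : 'M[R]_3 :=
  - mxint (ltime L 1) (ltime L k)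
      (fun s => mxint (ltime L 1) s (fun tau => (lrot L tau)^T)).

(* Error state: orientation, gyro bias, velocity, accelerometer bias, position,
   point feature. *)
Definition Phimx (k : nat) : 'M[R]_(3 + 3 + 3 + 3 + 3 + 3) :=
  col6
    (row6 (Phi11 k) (Phi12 k) 0    0         0    (0 : 'M[R]_3))
    (row6 0         1%:M      0    0         0    (0 : 'M[R]_3))
    (row6 (Phi31 k) (Phi32 k) 1%:M (Phi34 k) 0    (0 : 'M[R]_3))
    (row6 0         0         0    1%:M      0    (0 : 'M[R]_3))
    (row6 (Phi51 k) (Phi52 k) (Phi53 k) (Phi54 k) 1%:M (0 : 'M[R]_3))
    (row6 0         0         0    0         0    (1%:M : 'M[R]_3)).

Definition sensor_point (k : nat) : 'cV[R]_3 := rotk k *m (lfeat L - lpos L k).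

(* [h k] is the measurement function of the sensor at step k, in terms of the
   point position in the sensor frame; its outputs may be range, bearing, or
   both. The library's jacobian acts on row vectors, hence the transpositions. *)
Definition Hproj (d : nat -> nat) (h : forall k, 'rV[R]_3 -> 'rV[R]_(d k))
    (k : nat) : 'M[R]_(d k, 3) :=
  ('J (h k) (sensor_point k)^T)^T.

Definition Hmx (d : nat -> nat) (h : forall k, 'rV[R]_3 -> 'rV[R]_(d k))
    (k : nat) : 'M[R]_(d k, 3 + 3 + 3 + 3 + 3 + 3) :=
  Hproj h k *m rotk k
    *m row6 (crossmx (lfeat L - lpos L k) *m (rotk k)^T)
            (0 : 'M[R]_3) (0 : 'M[R]_3) (0 : 'M[R]_3) (- 1%:M) 1%:M.

(* Observability matrix of the steps 1, ..., n. *)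
Definition observability_mx (d : nat -> nat)
    (h : forall k, 'rV[R]_3 -> 'rV[R]_(d k)) (n : nat) :
    'M[R]_(\sum_(k < n) d k.+1, 3 + 3 + 3 + 3 + 3 + 3) :=
  \mxcol_(k < n) (Hmx h k.+1 *m Phimx k.+1).

Definition Ng : 'cV[R]_(3 + 3 + 3 + 3) :=
  col_mx (col_mx (col_mx (rotk 1 *m gravity g) 0)
                 (- (crossmx (lvel L 1) *m gravity g)))
         0.

Definition Nmx : 'M[R]_(3 + 3 + 3 + 3 + 3 + 3, 1 + 3) :=
  col_mx
    (col_mx (row_mx Ng                                (0 : 'M[R]_(_, 3)))
            (row_mx (- (crossmx (lpos L 1) *m gravity g)) 1%:M))
            (row_mx (- (crossmx (lfeat L) *m gravity g))  1%:M).

End AidedINS.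

(* Main.v *)
Require Import Defs.
From HB Require Import structures.
From mathcomp Require Import all_boot all_order all_algebra.
From mathcomp Require Import all_classical all_reals all_analysis.
From mathcomp Require Import ring.
Set Implicit Arguments.
Unset Strict Implicit.
Unset Printing Implicit Defensive.
Import Order.TTheory GRing.Theory Num.Theory.
Import numFieldNormedType.Exports.
Local Open Scope classical_set_scope.
Local Open Scope ring_scope.

(** The transition matrix maps the first column of N, an infinitesimal global
    rotation about the gravity axis written at step 1, to the same rotation
    written at step k: the gravity terms that integration adds to the velocity
    and the position vanish because [g x g = 0], and the bias columns meet zero
    blocks, so the integrals play no role. Global translations are fixed. Each
    [H_k] kills both kinds of directions since it only involves the relative
    position of the feature. The columns are independent because the
    orientation block [R_1 g] is nonzero, [R_1] being orthogonal. *)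

Section CrossProduct.
Context (R : realType).

Lemma crossmxD (a b : 'cV[R]_3) : crossmx (a + b) = crossmx a + crossmx b.
Proof.
apply/matrixP => -[[|[|[|//]]] ?] [[|[|[|//]]] ?];
  by rewrite !mxE/= ?mxE ?addr0 ?opprD.
Qed.

Lemma crossmxZ (c : R) (a : 'cV[R]_3) : crossmx (c *: a) = c *: crossmx a.
Proof.
apply/matrixP => -[[|[|[|//]]] ?] [[|[|[|//]]] ?];
  by rewrite !mxE/= ?mxE ?mulr0 ?mulrN.
Qed.

Lemma crossmxN (a : 'cV[R]_3) : crossmx (- a) = - crossmx a.
Proof. by rewrite -scaleN1r crossmxZ scaleN1r. Qed.

Lemma crossmx_self (a : 'cV[R]_3) : crossmx a *m a = 0.
Proof.
have sum3 (F : 'I_3 -> R) : \sum_i F i = F 0 + F 1 + F 2.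
  (* The indices left by [big_ord_recl] are lifts, equal to the numerals 1 and 2 only through their
     values. *)
  rewrite !big_ord_recl big_ord0 addr0 addrA.
  by congr (F _ + F _ + F _); apply: val_inj.
apply/matrixP => i j; rewrite ord1 !mxE sum3 !mxE /=.
by case: i => -[|[|[|//]]] ? /=; ring.
Qed.

End CrossProduct.

Lemma mul_col6_mx (R : realType) (m1 m2 m3 m4 m5 m6 n p : nat)
    (A1 : 'M[R]_(m1, n)) (A2 : 'M[R]_(m2, n)) (A3 : 'M[R]_(m3, n))
    (A4 : 'M[R]_(m4, n)) (A5 : 'M[R]_(m5, n)) (A6 : 'M[R]_(m6, n))
    (B : 'M[R]_(n, p)) :
  col6 A1 A2 A3 A4 A5 A6 *m B =
  col6 (A1 *m B) (A2 *m B) (A3 *m B) (A4 *m B) (A5 *m B) (A6 *m B).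
Proof. by rewrite /col6 !mul_col_mx. Qed.

Lemma mul_row6_col6 (R : realType) (m n1 n2 n3 n4 n5 n6 p : nat)
    (A1 : 'M[R]_(m, n1)) (A2 : 'M[R]_(m, n2)) (A3 : 'M[R]_(m, n3))
    (A4 : 'M[R]_(m, n4)) (A5 : 'M[R]_(m, n5)) (A6 : 'M[R]_(m, n6))
    (B1 : 'M[R]_(n1, p)) (B2 : 'M[R]_(n2, p)) (B3 : 'M[R]_(n3, p))
    (B4 : 'M[R]_(n4, p)) (B5 : 'M[R]_(n5, p)) (B6 : 'M[R]_(n6, p)) :
  row6 A1 A2 A3 A4 A5 A6 *m col6 B1 B2 B3 B4 B5 B6 =
  A1 *m B1 + A2 *m B2 + A3 *m B3 + A4 *m B4 + A5 *m B5 + A6 *m B6.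
Proof. by rewrite /row6 /col6 !mul_row_col. Qed.

Lemma gravity_neq0 (R : realType) (g : R) : g != 0 -> gravity g != 0.
Proof.
apply: contra_neq => /matrixP/(_ 2 0).
by rewrite !mxE /= => /eqP; rewrite oppr_eq0 => /eqP.
Qed.

Section UnobservableDirections.
Context (R : realType) (g : R) (L : linearization R).
Hypothesis rot_SO3 : forall tau : R, SO3 (lrot L tau).

Let rotk_orth (k : nat) : (rotk L k)^T *m rotk L k = 1%:M.
Proof. by case: (rot_SO3 (ltime L k)). Qed.

(** Regrouping N by columns puts each kind of direction in the six-block shape on which [Phimx] acts
    block by block. *)
Lemma Nmx_col6 : Nmx g L = row_mx
  (col6 (rotk L 1 *m gravity g) 0 (- (crossmx (lvel L 1) *m gravity g)) 0
        (- (crossmx (lpos L 1) *m gravity g))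
        (- (crossmx (lfeat L) *m gravity g)))
  (col6 0 0 0 0 1%:M 1%:M).
Proof.
by rewrite /Nmx /Ng /col6 !col_mx0 -[RHS]block_mxEh block_mxEv -block_mxEh block_mxEv.
Qed.

Lemma Phimx_gravity (k : nat) :
  Phimx g L k *m
    col6 (rotk L 1 *m gravity g) 0 (- (crossmx (lvel L 1) *m gravity g)) 0
      (- (crossmx (lpos L 1) *m gravity g))
      (- (crossmx (lfeat L) *m gravity g)) =
  col6 (rotk L k *m gravity g) 0 (- (crossmx (lvel L k) *m gravity g)) 0
    (- (crossmx (lpos L k) *m gravity g))
    (- (crossmx (lfeat L) *m gravity g)).
Proof.
rewrite /Phimx mul_col6_mx !mul_row6_col6.
rewrite !mul0mx !mulmx0 !mul1mx !addr0 !add0r.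
have RTR (A : 'M[R]_3) : A *m (rotk L 1)^T *m (rotk L 1 *m gravity g) =
    A *m gravity g by rewrite -mulmxA (mulmxA _^T) rotk_orth mul1mx.
congr col6.
- by rewrite /Phi11 RTR.
(* Velocity block: the V_1 x g released by [Phi31] cancels the one carried by the column. *)
- rewrite /Phi31 mulNmx RTR !(crossmxD, crossmxN, crossmxZ) !mulmxDl.
  rewrite -scalemxAl crossmx_self scaler0 addr0 mulNmx -opprD.
  by rewrite subrK.
(* Position block: [Phi53] times the velocity block cancels the V_1 x g term of [Phi51], and the
   position block cancels its P_1 x g term. *)
- rewrite /Phi51 RTR !(crossmxD, crossmxN, crossmxZ) !mulmxDl !mulNmx.
  rewrite -!scalemxAl crossmx_self scaler0 subr0 mul_scalar_mx.
  rewrite scalerN -addrA -opprD [_ + crossmx (lpos L 1) *m _]addrC.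
  by rewrite addrAC subrr add0r.
Qed.

Lemma Phimx_translation (k : nat) :
  Phimx g L k *m col6 0 0 0 0 1%:M 1%:M =
  col6 0 0 0 0 (1%:M : 'M[R]_3) (1%:M : 'M[R]_3).
Proof.
rewrite /Phimx mul_col6_mx !mul_row6_col6.
by rewrite !mul0mx !mulmx0 !mul1mx !addr0 !add0r.
Qed.

(** The cancellation takes place in the [row6] factor of [Hmx], to the right of [Hproj]. *)
Lemma Hmx_Phimx_Nmx (d : nat -> nat)
    (h : forall k : nat, 'rV[R]_3 -> 'rV[R]_(d k)) (k : nat) :
  Hmx L h k *m Phimx g L k *m Nmx g L = 0.
Proof.
rewrite Nmx_col6 -mulmxA mul_mx_row Phimx_gravity Phimx_translation.
rewrite mul_mx_row /Hmx -!mulmxA !mul_row6_col6.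
rewrite !mul0mx !mulmx0 !mul1mx !mulNmx !mul1mx !addr0 !add0r addNr.
rewrite -mulmxA (mulmxA (rotk L k)^T) rotk_orth mul1mx opprK.
(* What remains is (p - P_k) x g + P_k x g - p x g. *)
rewrite crossmxD crossmxN mulmxDl mulNmx subrK subrr.
by rewrite !mulmx0 row_mx0.
Qed.

Lemma Nmx_free : g != 0 -> row_free (Nmx g L)^T.
Proof.
move=> g0; apply: inj_row_free => v /(congr1 trmx).
rewrite trmx_mul trmxK trmx0 -[v^T]vsubmxK Nmx_col6 mul_row_col.
(* [a] is the coefficient of the gravity column, [b] those of the translations. *)
set a := usubmx v^T; set b := dsubmx v^T.
rewrite !mul_col6_mx !mul0mx !mul1mx.
rewrite /col6 !add_col_mx -!col_mx0.
(* Two blocks suffice: the orientation block, free of [b], forces [a] = 0, and then the position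
   block [Hp] reads [b] = 0. *)
move/eq_col_mx => [/eq_col_mx[/eq_col_mx[/eq_col_mx[/eq_col_mx[+ _] _] _] Hp] _].
rewrite addr0 => /(congr1 (mulmx (rotk L 1)^T)).
rewrite mulmx0 !mulmxA rotk_orth mul1mx => /eqP.
rewrite (mx11_scalar a) mul_mx_scalar scaler_eq0 (negPf (gravity_neq0 g0)) orbF.
move=> /eqP a00.
have a0 : a = 0 by rewrite (mx11_scalar a) a00 raddf0.
move: Hp; rewrite a0 mulmx0 add0r => b0.
by rewrite -[v]trmxK -[v^T]vsubmxK -/a -/b a0 b0 col_mx0 trmx0.
Qed.

End UnobservableDirections.

Theorem mainTheorem2 (R : realType) (g : R) (L : linearization R)
    (d : nat -> nat) (h : forall k : nat, 'rV[R]_3 -> 'rV[R]_(d k))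
    (g_gt0 : 0 < g)
    (time_lt : forall i j : nat, (0 < i)%N -> (i < j)%N -> ltime L i < ltime L j)
    (rot_SO3 : forall tau : R, SO3 (lrot L tau))
    (h_diff : forall k : nat, (0 < k)%N ->
       differentiable (h k) (sensor_point L k)^T) :
  row_free (Nmx g L)^T /\
  forall n : nat, observability_mx g L h n *m Nmx g L = 0.
Proof.
split; first exact: (Nmx_free rot_SO3 (lt0r_neq0 g_gt0)).
move=> n; rewrite /observability_mx mxcol_mul.
under eq_mxcol => k do rewrite (Hmx_Phimx_Nmx g rot_SO3).
by rewrite mxcol0.
Qed.
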